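(* Let $n$ be a positive integer. When $n=2k$, $$B_{2k}(s,t,q)=q^{n^2}s^kt^kB_{2k}\Big(\frac1s,\frac1t,\frac1q\Big),$$ and when $n=2k+1$, $$B_{2k+1}(s,t,q)=q^{n^2}s^{k+1}t^kB_{2k+1}\Big(\frac1s,\frac1t,\frac1q\Big).$$
   Context: $\mathfrak{B}_n$ is the group of permutations $\pi$ of $\{\pm1,\dots,\pm n\}$ with $\pi(-i)=-\pi(i)$; write $\pi_i=\pi(i)$ and set $\pi_0=0$. For $\pi\in\mathfrak{B}_n$: $\mathrm{edes}_B(\pi)$ (resp. $\mathrm{odes}_B(\pi)$) is the number of even (resp. odd) indices $i\in\{0,1,\dots,n-1\}$ with $\pi_i>\pi_{i+1}$. The type B inversion number is $$\mathrm{inv}_B(\pi)=|\{1\le i<j\le n:\pi_i>\pi_j\}|+|\{1\le i<j\le n:-\pi_i>\pi_j\}|+|\{1\le i\le n:\pi_i<0\}|.$$ $B_n(s,t,q)=\sum_{\pi\in\mathfrak{B}_n}s^{\mathrm{edes}_B(\pi)}t^{\mathrm{odes}_B(\pi)}q^{\mathrm{inv}_B(\pi)}$. *)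

(* Defs.v *)
From HB Require Import structures.
From mathcomp Require Import all_boot all_order all_algebra all_fingroup.

Set Implicit Arguments.
Unset Strict Implicit.
Unset Printing Implicit Defensive.

Import Order.TTheory GRing.Theory Num.Theory.
Local Open Scope ring_scope.

(* The alphabet {-n, ..., -1, 1, ..., n}: the pair (b, i) stands for the
   integer (-1)^b * (i + 1). *)
Definition letter (n : nat) : finType := (bool * 'I_n)%type.

Definition letter_val (n : nat) (x : letter n) : int :=
  (-1) ^+ x.1 * (x.2.+1)%:Z.

Definition letter_opp (n : nat) (x : letter n) : letter n := (~~ x.1, x.2).

Lemma letter_val_opp n (x : letter n) :
  letter_val (letter_opp x) = - letter_val x.
Proof. by case: x => [[] i]; rewrite /letter_val /= ?mulN1r ?mul1r ?opprK. Qed.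

Lemma letter_val_inj n : injective (@letter_val n).
Proof.
move=> [b i] [c j]; rewrite /letter_val /=.
by case: b; case: c; rewrite ?expr1 ?expr0 ?mulN1r ?mul1r => // [] [] /val_inj ->.
Qed.

Lemma letter_valP n (z : int) :
  reflect (exists x : letter n, letter_val x = z) (0 < `|z| <= n%:Z).
Proof.
apply: (iffP andP) => [[z0 zn]|[[b i] <-]]; last first.
  by rewrite /letter_val normrM normrX normrN1 expr1n mul1r; split; case: i.
case: z z0 zn => [[|m]|m] // _; rewrite ?NegzE ?normrN => mn.
  by exists (false, Ordinal (mn : (m < n)%N)); rewrite /letter_val /= mul1r.
by exists (true, Ordinal (mn : (m < n)%N)); rewrite /letter_val /= mulN1r.
Qed.

(* The hyperoctahedral group: permutations pi with pi (- x) = - pi x. *)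
Definition signed_perms (n : nat) : {set {perm letter n}} :=
  [set pi : {perm letter n} |
    [forall x, pi (letter_opp x) == letter_opp (pi x)]].

Lemma signed_perms_group_set n : group_set (signed_perms n).
Proof.
apply/group_setP; split=> [|p r].
  by rewrite inE; apply/forallP => x; rewrite !perm1.
rewrite !inE => /forallP hp /forallP hr; apply/forallP => x.
by rewrite !permM (eqP (hp x)) (eqP (hr _)).
Qed.
Canonical signed_perms_group n := Group (signed_perms_group_set n).

(* pi_i for 0 <= i <= n, with pi_0 = 0: [unlift ord0 i] is [None] when i = 0,
   and otherwise [Some j] with i = j + 1, so that (false, j) is the letter i. *)
Definition entry (n : nat) (pi : {perm letter n}) (i : 'I_n.+1) : int :=
  if unlift ord0 i is Some j then letter_val (pi (false, j)) else 0.

Definition descent (n : nat) (pi : {perm letter n}) (i : 'I_n) : bool :=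
  entry pi (lift ord0 i) < entry pi (widen_ord (leqnSn n) i).

Definition edesB (n : nat) (pi : {perm letter n}) : nat :=
  #|[set i : 'I_n | ~~ odd i & descent pi i]|.

Definition odesB (n : nat) (pi : {perm letter n}) : nat :=
  #|[set i : 'I_n | odd i & descent pi i]|.

Definition invB (n : nat) (pi : {perm letter n}) : nat :=
  (#|[set p : 'I_n.+1 * 'I_n.+1 |
       (0 < p.1 < p.2)%N & (entry pi p.2 < entry pi p.1)%R]|
   + #|[set p : 'I_n.+1 * 'I_n.+1 |
       (0 < p.1 < p.2)%N & (entry pi p.2 < - entry pi p.1)%R]|
   + #|[set i : 'I_n.+1 | (0 < i)%N & (entry pi i < 0)%R]|)%N.

(* The generating polynomial B_n, evaluated at elements of a commutative ring. *)
Definition Bpoly (R : comNzRingType) (n : nat) (s t q : R) : R :=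
  \sum_(pi in signed_perms n) s ^+ edesB pi * t ^+ odesB pi * q ^+ invB pi.

(* Main.v *)
Require Import Defs.
From mathcomp Require Import all_boot all_order all_algebra all_fingroup.
From mathcomp Require Import zify ring.

Import Order.TTheory GRing.Theory Num.Theory.
Local Open Scope ring_scope.

(** Multiplying a signed permutation by the central element [-1] negates every
    entry while keeping [pi_0 = 0]. The entries [pi_0, ..., pi_n] have pairwise
    distinct absolute values, so each comparison counted by a descent or an
    inversion is strict, and negation reverses it: exactly one of [pi] and
    [- pi] realizes any given descent position or inversion. Hence each
    statistic of [pi] and the same statistic of [- pi] add up to the number of
    places where it could occur: [uphalf n] even indices, [n./2] odd indices,
    and ['C(n, 2) + 'C(n, 2) + n = n ^ 2] inversions. The functional equation is
    the reindexing of the defining sum by the involution [pi |-> - pi]. *)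

Lemma card_complementary (T : finType) (P Q Q' : pred T) :
  {in P, forall x, Q' x = ~~ Q x} ->
  (#|[set x | P x & Q x]| + #|[set x | P x & Q' x]| = #|[set x | P x]|)%N.
Proof.
move=> QC; rewrite -(cardsID [set x | Q x] [set x | P x]).
congr (_ + _)%N; apply: eq_card => x; rewrite !inE //.
by have [/QC ->|] := boolP (P x); rewrite ?andbT // andbF.
Qed.

Lemma card_even_ord n : #|[set i : 'I_n | ~~ odd i]| = uphalf n.
Proof.
rewrite cardsE -sum1_card big_mkcond /=.
elim: n => [|n IHn]; first by rewrite big_ord0.
rewrite big_ord_recr /= IHn unfold_in uphalf_half /=.
by case: (odd n); rewrite /= ?addn0 ?addn1.
Qed.

Lemma card_odd_ord n : #|[set i : 'I_n | odd i]| = n./2.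
Proof.
rewrite cardsE -sum1_card big_mkcond /=.
elim: n => [|n IHn]; first by rewrite big_ord0.
rewrite big_ord_recr /= IHn unfold_in uphalf_half /=.
by case: (odd n); rewrite /= ?addn0 ?addn1.
Qed.

Lemma card_pos_ord n : #|[set i : 'I_n.+1 | (0 < i)%N]| = n.
Proof.
rewrite cardsE -sum1_card big_mkcond big_ord_recl /=.
by rewrite sum1_card card_ord.
Qed.

Lemma card_pos_ltn_pairs n :
  #|[set p : 'I_n.+1 * 'I_n.+1 | (0 < p.1 < p.2)%N]| = 'C(n, 2).
Proof.
rewrite cardsE -sum1_card big_mkcond /=.
rewrite -(pair_bigA _ (fun i j : 'I_n.+1 => if (0 < i < j)%N then 1%N else 0%N)).
rewrite exchange_big -bin2_sum big_mkord big_ord_recl /=.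
rewrite big1 => [|i _]; last by rewrite ltn0 andbF.
rewrite add0n; apply: eq_bigr => j _; rewrite big_ord_recl /= add0n.
rewrite -big_mkcond -[RHS](card_ord j) -sum1_card.
by rewrite (big_ord_widen n (fun=> 1%N) (ltnW (ltn_ord j))).
Qed.

Lemma letter_oppK n : involutive (@letter_opp n).
Proof. by case=> b i; rewrite /letter_opp /= negbK. Qed.

(** The central element [-1] of the hyperoctahedral group, which is also its
    longest element for the length function [invB]. *)
Definition neg_perm n : {perm letter n} := perm (can_inj (@letter_oppK n)).

Lemma neg_perm_signed n : neg_perm n \in signed_perms n.
Proof. by rewrite inE; apply/forallP=> x; rewrite !permE. Qed.

Lemma entry_mul_neg_perm n (pi : {perm letter n}) i :
  entry (pi * neg_perm n)%g i = - entry pi i.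
Proof.
rewrite /entry; case: unliftP => [j _|_]; last by rewrite oppr0.
by rewrite permM permE letter_val_opp.
Qed.

Lemma letter_val_neq0 n (x : letter n) : letter_val x != 0.
Proof. by rewrite mulf_neq0 // signr_eq0. Qed.

Lemma entry_inj n (pi : {perm letter n}) : injective (entry pi).
Proof.
move=> i j; rewrite /entry; case: unliftP => [i' ->|->]; case: unliftP => [j' ->|->] //.
- by move/letter_val_inj/perm_inj => [->].
- by move/eqP; rewrite (negPf (letter_val_neq0 _ _)).
- by move/esym/eqP; rewrite (negPf (letter_val_neq0 _ _)).
Qed.

(** A signed permutation sends the letter [- j] to [- pi_j], so
    [pi_i = - pi_j] would force the positive letter [i] to be the negative letter
    [- j] when [j > 0]; and for [j = 0] it would make [pi_i] zero. *)
Lemma entry_neq_opp n (pi : {perm letter n}) (i j : 'I_n.+1) :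
  pi \in signed_perms n -> (0 < i)%N -> entry pi i != - entry pi j.
Proof.
rewrite inE => /forallP piN; rewrite /entry; case: unliftP => [i' -> _|-> //].
case: unliftP => [j' _|_]; last by rewrite oppr0 letter_val_neq0.
rewrite -letter_val_opp -(eqP (piN _)).
by apply/eqP => /letter_val_inj/perm_inj.
Qed.

Lemma descent_mul_neg_perm n (pi : {perm letter n}) i :
  descent (pi * neg_perm n)%g i = ~~ descent pi i.
Proof.
rewrite /descent !entry_mul_neg_perm ltrN2 -leNgt lt_neqAle.
rewrite (inj_eq (@entry_inj _ pi)) -val_eqE /= /bump /=.
by rewrite neq_ltn ltnSn.
Qed.

Lemma edesB_mul_neg_perm n (pi : {perm letter n}) :
  (edesB pi + edesB (pi * neg_perm n)%g = uphalf n)%N.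
Proof.
rewrite -card_even_ord; apply: card_complementary => i _.
exact: descent_mul_neg_perm.
Qed.

Lemma odesB_mul_neg_perm n (pi : {perm letter n}) :
  (odesB pi + odesB (pi * neg_perm n)%g = n./2)%N.
Proof.
rewrite -card_odd_ord; apply: card_complementary => i _.
exact: descent_mul_neg_perm.
Qed.

(** Each of the three counts in [invB] is complemented separately: strictness of
    the comparisons comes from injectivity of the entries, from
    [pi_j <> - pi_i], and from [pi_i <> 0 = - pi_0] respectively. *)
Lemma invB_mul_neg_perm n (pi : {perm letter n}) :
  pi \in signed_perms n -> (invB pi + invB (pi * neg_perm n)%g = n ^ 2)%N.
Proof.
move=> piB; rewrite /invB.
have n2E : ('C(n, 2) + 'C(n, 2) + n = n ^ 2)%N.
  by elim: n {piB pi} => // n IHn; rewrite binS bin1; lia.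
rewrite -[RHS]n2E -{1 2}card_pos_ltn_pairs -[X in (_ = _ + X)%N]card_pos_ord.
rewrite addnACA [X in (X + _)%N = _]addnACA; congr (_ + _ + _)%N.
- apply: card_complementary => -[i j]; rewrite unfold_in /= => /andP[_ ltij].
  rewrite !entry_mul_neg_perm ltrN2 -leNgt lt_neqAle.
  by rewrite (inj_eq (@entry_inj _ pi)) -val_eqE neq_ltn ltij.
- apply: card_complementary => -[i j]; rewrite unfold_in /= => /andP[i0 ltij].
  rewrite !entry_mul_neg_perm ltrN2 -leNgt lt_neqAle eq_sym.
  by rewrite entry_neq_opp // (ltn_trans i0).
- apply: card_complementary => i; rewrite unfold_in => i0.
  have pi0 : entry pi ord0 = 0 by rewrite /entry unlift_none.
  have := entry_neq_opp _ _ _ ord0 piB i0.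
  by rewrite entry_mul_neg_perm oppr_lt0 pi0 oppr0 -leNgt lt_neqAle eq_sym => ->.
Qed.

Lemma expr_complement (R : unitRingType) (x : R) (a b c : nat) :
  x \is a GRing.unit -> (a + b = c)%N -> x ^+ c * x^-1 ^+ b = x ^+ a.
Proof. by move=> xU <-; rewrite exprD exprVn mulrK ?unitrX. Qed.

Lemma Bpoly_reciprocal (R : comUnitRingType) (n : nat) (s t q : R) :
  s \is a GRing.unit -> t \is a GRing.unit -> q \is a GRing.unit ->
  Bpoly n s t q
  = q ^+ (n ^ 2)%N * s ^+ uphalf n * t ^+ n./2 * Bpoly n s^-1 t^-1 q^-1.
Proof.
move=> sU tU qU; rewrite /Bpoly [in RHS](reindex_inj (mulIg (neg_perm n))) /=.
rewrite mulr_sumr; apply: eq_big => [pi|pi piB].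
  by rewrite groupMr // neg_perm_signed.
rewrite -(expr_complement _ _ _ _ _ sU (edesB_mul_neg_perm _ pi)).
rewrite -(expr_complement _ _ _ _ _ tU (odesB_mul_neg_perm _ pi)).
rewrite -(expr_complement _ _ _ _ _ qU (invB_mul_neg_perm _ _ piB)).
by ring.
Qed.

Theorem lemma26 (R : comUnitRingType) (n k : nat) (s t q : R)
    (hn : (0 < n)%N) (hs : s \is a GRing.unit) (ht : t \is a GRing.unit)
    (hq : q \is a GRing.unit) :
  (n = (2 * k)%N ->
     Bpoly n s t q
     = q ^+ (n ^ 2)%N * s ^+ k * t ^+ k * Bpoly n s^-1 t^-1 q^-1)
  /\
  (n = (2 * k + 1)%N ->
     Bpoly n s t q
     = q ^+ (n ^ 2)%N * s ^+ (k + 1)%N * t ^+ k * Bpoly n s^-1 t^-1 q^-1).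
Proof.
split=> nE; rewrite {1}(Bpoly_reciprocal _ n _ _ _ hs ht hq).
  have -> : uphalf n = k by lia.
  by have -> : n./2 = k by lia.
have -> : uphalf n = (k + 1)%N by lia.
by have -> : n./2 = k by lia.
Qed.
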